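(* Let $f:\mathbb{R}^n\to\mathbb{R}$ be a uniform CN function with CN form $f=[g:g_1,\dots,g_r]$, and let $(\bm x^*,\bm y^* )\in X(f)$. Consider the problem $$(\mathrm{UCNP})(\bm x^*,\bm y^* ):\quad\min\ \nabla g(\bm x^*,\bm y^* )^\top\bm d+\tfrac{\bar\rho}{2}\|\bm d\|^2\quad\text{s.t. }\bm d\in T(\bm x^*,\bm y^* ).$$ If $\bm d^*$ is an optimal solution to $(\mathrm{UCNP})(\bm x^*,\bm y^* )$ such that $\nabla g(\bm x^*,\bm y^* )^\top\bm d^*+\frac{\bar\rho}{2}\|\bm d^*\|^2\ge0$, then $(\bm x^*,\bm y^* )$ is an optimal solution to (CNP) and $\bm x^*$ is an optimal solution to (CNO). Furthermore, if there is a $\bm d'$ such that $\nabla g_i(\bm x^*,\bm y^* )^\top\bm d'<0$, $i=1,\dots,r$, then there are $\alpha_i^*\ge0$, $i=1,\dots,r$, such that $$\bar\rho\,\bm d^*+\nabla g(\bm x^*,\bm y^* )+\sum_{i=1}^r\alpha_i^*\nabla g_i(\bm x^*,\bm y^* )=0,\qquad\alpha_i^*\nabla g_i(\bm x^*,\bm y^* )^\top\bm d^*=0,\ i=1,\dots,r.\quad(\ast)$$ Conversely, if there are $\bm d^*\in T(\bm x^*,\bm y^* )$ and $\alpha_i^*\ge0$, $i=1,\dots,r$, such that $(\ast)$ holds, then $\bm d^*$ is an optimal solution to $(\mathrm{UCNP})(\bm x^*,\bm y^* )$.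
   Context: Let $f:\mathbb{R}^n\to\mathbb{R}$ be nonconvex and let $g,g_1,\dots,g_r:\mathbb{R}^n\times\mathbb{R}^m\to\mathbb{R}$ ($r\ge1$) be convex. Put $X(\bm g)=\{(\bm x,\bm y)\in\mathbb{R}^n\times\mathbb{R}^m: g_i(\bm x,\bm y)=0,\ i=1,\dots,r\}$. The function $f$ is a CN (convertible nonconvex) function with CN form $f=[g:g_1,\dots,g_r]$ if for each $\bm x\in\mathbb{R}^n$ there is $\bm y\in\mathbb{R}^m$ with $(\bm x,\bm y)\in X(\bm g)$ and $f(\bm x)=g(\bm x,\bm y)=\min_{(\bm x,\bm y')\in X(\bm g)}g(\bm x,\bm y')$. Put $X(f)=\{(\bm x,\bm y)\in X(\bm g): f(\bm x)=g(\bm x,\bm y)\}$. $f$ is a uniform CN function if moreover $g$ is uniform convex: there is $\bar\rho>0$ (fixed) with $g((\bm x,\bm y)+\bm d)-g(\bm x,\bm y)\ge\nabla g(\bm x,\bm y)^\top\bm d+\frac{\bar\rho}{2}\|\bm d\|^2$ for all $(\bm x,\bm y),\bm d\in\mathbb{R}^n\times\mathbb{R}^m$. Standing assumption: $g,g_1,\dots,g_r$ are twice differentiable ($f$ need not be differentiable). (CNO): $\min f(\bm x)$ s.t. $\bm x\in\mathbb{R}^n$. (CNP): $\min g(\bm x,\bm y)$ s.t. $(\bm x,\bm y)\in\mathbb{R}^n\times\mathbb{R}^m$, $g_i(\bm x,\bm y)=0$, $i=1,\dots,r$. ''Optimal solution'' means global minimizer. $T(\bm x,\bm y)=\{\bm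 d\in\mathbb{R}^n\times\mathbb{R}^m:\nabla g_i(\bm x,\bm y)^\top\bm d\le0,\ i=1,\dots,r\}$. *)

(* Defs.v *)
From HB Require Import structures.
From mathcomp Require Import all_boot all_order all_algebra.
From mathcomp Require Import all_classical all_reals all_analysis.

Set Implicit Arguments.
Unset Strict Implicit.
Unset Printing Implicit Defensive.

Import Order.TTheory GRing.Theory Num.Theory.
Import numFieldNormedType.Exports.

Local Open Scope classical_set_scope.
Local Open Scope ring_scope.

(* A point (x, y) of R^n x R^m is encoded as the row vector [row_mx x y] of
   length n + m. *)

(* MathComp-Analysis equips 'rV[R]_k with the sup norm; the norm meant here is the
   Euclidean one, hence [enorm].  (Differentiability does not depend on which
   of the two is used.) *)
Definition dot (R : realType) (k : nat) (u v : 'rV[R]_k) : R :=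
  \sum_(j < k) u 0 j * v 0 j.

Definition enorm (R : realType) (k : nat) (u : 'rV[R]_k) : R :=
  Num.sqrt (dot u u).

Definition gradient (R : realType) (k : nat) (h : 'rV[R]_k -> R)
    (p : 'rV[R]_k) : 'rV[R]_k :=
  \row_(j < k) 'D_(delta_mx 0 j) h p.

Definition twice_differentiable (R : realType) (k : nat) (h : 'rV[R]_k -> R) :
    Prop :=
  (forall p, differentiable h p) /\ (forall p, differentiable (gradient h) p).

Definition convex_on_space (R : realType) (k : nat) (h : 'rV[R]_k -> R) : Prop :=
  convex_function setT h.

Definition optimal_solution (R : realType) (T : Type) (F : T -> R) (A : set T)
    (z : T) : Prop :=
  A z /\ forall w, A w -> F z <= F w.

Section CN.
Variables (R : realType) (n m r : nat).
Implicit Types (f : 'rV[R]_n -> R) (g : 'rV[R]_(n + m) -> R).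
Implicit Types (gs : 'I_r -> 'rV[R]_(n + m) -> R).

Definition Xcstr gs : set 'rV[R]_(n + m) := [set p | forall i, gs i p = 0].

(* f = [g : g_1, ..., g_r]; the minimum over (x, y') in X(g_1, ..., g_r) is taken
   over y' alone, x being fixed. *)
Definition CN_form f g gs : Prop :=
  [/\ ~ convex_on_space f,
      convex_on_space g,
      forall i, convex_on_space (gs i)
    & forall x, exists y,
        optimal_solution (fun y' => g (row_mx x y'))
          [set y' | Xcstr gs (row_mx x y')] y
        /\ f x = g (row_mx x y)].

Definition Xfun f g gs : set 'rV[R]_(n + m) :=
  [set p | Xcstr gs p /\ f (lsubmx p) = g p].

Definition uniform_convex (rho : R) g : Prop :=
  0 < rho /\
  forall p d : 'rV[R]_(n + m),
    g (p + d) - g p >= dot (gradient g p) d + rho / 2 * enorm d ^+ 2.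

Definition uniform_CN_form (rho : R) f g gs : Prop :=
  CN_form f g gs /\ uniform_convex rho g.

Definition CNO_optimal f (x : 'rV[R]_n) : Prop := optimal_solution f setT x.

Definition CNP_optimal g gs (p : 'rV[R]_(n + m)) : Prop :=
  optimal_solution g (Xcstr gs) p.

Definition Tcone gs (p : 'rV[R]_(n + m)) : set 'rV[R]_(n + m) :=
  [set d | forall i, dot (gradient (gs i) p) d <= 0].

Definition UCNP_objective (rho : R) g (p d : 'rV[R]_(n + m)) : R :=
  dot (gradient g p) d + rho / 2 * enorm d ^+ 2.

Definition UCNP_optimal (rho : R) g gs (p d : 'rV[R]_(n + m)) : Prop :=
  optimal_solution (UCNP_objective rho g p) (Tcone gs p) d.

Definition UCNP_KKT (rho : R) g gs (p d : 'rV[R]_(n + m)) (alpha : 'I_r -> R) :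
    Prop :=
  rho *: d + gradient g p + \sum_(i < r) alpha i *: gradient (gs i) p = 0
  /\ forall i, alpha i * dot (gradient (gs i) p) d = 0.

End CN.

(* Main.v *)
Require Import Defs.
From HB Require Import structures.
From mathcomp Require Import all_boot all_order all_algebra.
From mathcomp Require Import ring lra.
From mathcomp Require Import all_classical all_reals all_analysis.
Import Order.TTheory GRing.Theory Num.Theory.
Import numFieldNormedType.Exports.
Local Open Scope classical_set_scope.
Local Open Scope ring_scope.

(** Write p for the given point and c = rho d + grad g(p) for the gradient of the
    objective of UCNP(p) at d.

    Global optimality.  If q is another feasible point of (CNP), every g_i is
    convex and vanishes at both p and q, so it cannot increase to first order
    from p towards q: q - p lies in the cone T(p)
    ([feasible_direction_Tcone]).  Uniform convexity of g bounds g(q) - g(p) from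
    below by the UCNP objective at q - p, hence by its minimum, which is
    assumed nonnegative.  So p minimizes g on the feasible set, and since f(x) is
    always attained as a value of g at a feasible point, x* minimizes f.

    Multipliers.  The objective is quadratic, and its expansion around d is exact:
    it is its value at d, plus c.z, plus rho/2 |z|^2 ([UCNP_objectiveD]).  At a
    minimizer d over the cone T(p), moving along d + t w for w in T(p), and
    along d - t d, gives c.w >= 0 for all w in T(p) and c.d <= 0.
    Farkas' lemma ([farkas]) turns the former into -c = sum_i alpha_i grad g_i(p)
    with alpha >= 0.  Pairing this with d gives a sum of nonpositive terms
    alpha_i grad g_i(p).d whose value -c.d is nonnegative, so each term vanishes.

    Converse.  With (alpha, d) satisfying the KKT system, c.(w - d) is
    - sum_i alpha_i grad g_i(p).w >= 0 for w in T(p), and the exact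
    expansion shows that d is a minimizer. *)

Set Implicit Arguments.
Unset Strict Implicit.

(** * The Euclidean inner product *)

Lemma dotC (R : realType) (k : nat) (u v : 'rV[R]_k) : dot u v = dot v u.
Proof. by apply: eq_bigr => j _; rewrite mulrC. Qed.

Lemma dotDl (R : realType) (k : nat) (u v w : 'rV[R]_k) :
  dot (u + v) w = dot u w + dot v w.
Proof. by rewrite /dot -big_split; apply: eq_bigr => j _; rewrite mxE mulrDl. Qed.

Lemma dotZl (R : realType) (k : nat) (c : R) (u v : 'rV[R]_k) :
  dot (c *: u) v = c * dot u v.
Proof. by rewrite /dot mulr_sumr; apply: eq_bigr => j _; rewrite mxE mulrA. Qed.

Lemma dotDr (R : realType) (k : nat) (u v w : 'rV[R]_k) :
  dot u (v + w) = dot u v + dot u w.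
Proof. by rewrite dotC dotDl !(dotC u). Qed.

Lemma dotZr (R : realType) (k : nat) (c : R) (u v : 'rV[R]_k) :
  dot u (c *: v) = c * dot u v.
Proof. by rewrite dotC dotZl dotC. Qed.

Lemma dotNl (R : realType) (k : nat) (u v : 'rV[R]_k) : dot (- u) v = - dot u v.
Proof. by rewrite -scaleN1r dotZl mulN1r. Qed.

Lemma dotNr (R : realType) (k : nat) (u v : 'rV[R]_k) : dot u (- v) = - dot u v.
Proof. by rewrite dotC dotNl dotC. Qed.

Lemma dot0l (R : realType) (k : nat) (v : 'rV[R]_k) : dot 0 v = 0.
Proof. by rewrite -(scale0r 0) dotZl mul0r. Qed.

Lemma dot_suml (R : realType) (k r : nat) (a : 'I_r -> 'rV[R]_k) (v : 'rV[R]_k) :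
  dot (\sum_i a i) v = \sum_i dot (a i) v.
Proof.
exact: (big_morph (fun u => dot u v) (fun x y => dotDl x y v) (dot0l v)).
Qed.

Lemma dotvv_ge0 (R : realType) (k : nat) (u : 'rV[R]_k) : 0 <= dot u u.
Proof. by apply: sumr_ge0 => j _; rewrite -expr2 sqr_ge0. Qed.

Lemma dotvv_eq0 (R : realType) (k : nat) (u : 'rV[R]_k) : dot u u = 0 -> u = 0.
Proof.
move=> /eqP; rewrite psumr_eq0 => [/allP u0|j _]; last by rewrite -expr2 sqr_ge0.
apply/rowP => j; rewrite mxE; apply/eqP.
by have := u0 j (mem_index_enum _); rewrite mulf_eq0 orbb.
Qed.

Lemma enorm2 (R : realType) (k : nat) (u : 'rV[R]_k) : enorm u ^+ 2 = dot u u.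
Proof. by rewrite /enorm sqr_sqrtr ?dotvv_ge0. Qed.

(** * Farkas' lemma *)

(** Induction on the number of vectors a_i (the argument of Bartl).  If the last
    vector a_max can be dropped, give it coefficient 0.  Otherwise there
    is y with a_max.y = 1, a_i.y <= 0 for the other i and v.y > 0; the induction
    hypothesis applies to the vectors projected along a_max onto the orthogonal
    complement of y, and lifting the resulting combination back adds to a_max a
    coefficient whose sign is forced by those of the a_i.y and of v.y. *)
Lemma farkas (R : realType) (k r : nat) (a : 'I_r -> 'rV[R]_k) (v : 'rV[R]_k) :
  (forall w, (forall i, dot (a i) w <= 0) -> dot v w <= 0) ->
  exists alpha : 'I_r -> R,
    (forall i, 0 <= alpha i) /\ v = \sum_i alpha i *: a i.
Proof.
elim: r a v => [|r IHr] a v av.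
  (* With no constraint, v can be tested against itself. *)
  exists (fun=> 0); split => //; rewrite big_ord0; apply: dotvv_eq0.
  by apply/eqP; rewrite eq_le dotvv_ge0 av // => -[].
pose a' i := a (widen_ord (leqnSn r) i).
have split_ord w : (forall i, dot (a' i) w <= 0) -> dot (a ord_max) w <= 0 ->
    forall i, dot (a i) w <= 0.
  move=> a'w amw i; have [ir|ri] := ltnP i r.
    by have := a'w (Ordinal ir); rewrite /a' (_ : widen_ord _ _ = i) //; exact: val_inj.
  rewrite (_ : i = ord_max) //; apply: val_inj => /=.
  by apply/eqP; rewrite eqn_leq ri -ltnS ltn_ord.
pose glue (beta : 'I_r -> R) c (i : 'I_r.+1) :=
  if insub (val i) is Some j then beta j else c.
have glueE beta c : \sum_i glue beta c i *: a i =
    \sum_i beta i *: a' i + c *: a ord_max.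
  rewrite big_ord_recr /=; congr (_ + _ *: _).
    apply: eq_bigr => i _; congr (_ *: _).
    by rewrite /glue /= insubT //= => ir; congr beta; exact: val_inj.
  by rewrite /glue /= insubF ?ltnn.
have glue_ge0 beta c : (forall i, 0 <= beta i) -> 0 <= c ->
    forall i, 0 <= glue beta c i.
  by move=> beta0 c0 i; rewrite /glue; case: insubP.
have [/IHr[beta [beta0 vE]]|] :=
    pselect (forall w, (forall i, dot (a' i) w <= 0) -> dot v w <= 0).
  exists (glue beta 0); split; first exact: glue_ge0.
  by rewrite glueE scale0r addr0.
move=> /existsNP[x] /not_implyP[a'x] /negP; rewrite -ltNge => vx.
have {}amx : 0 < dot (a ord_max) x.
  rewrite ltNge; apply/negP => amx; move: vx; rewrite ltNge => /negP; apply.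
  by apply: av; exact: split_ord.
pose y := (dot (a ord_max) x)^-1 *: x.
have amy : dot (a ord_max) y = 1 by rewrite dotZr mulVf // gt_eqF.
have a'y i : dot (a' i) y <= 0 by rewrite dotZr mulr_ge0_le0 // invr_ge0 ltW.
have vy : 0 < dot v y by rewrite dotZr mulr_gt0 // invr_gt0.
(* [shear] is the oblique projection with kernel spanned by a_max and range
   the orthogonal complement of y; [shearE] gives its adjoint, which maps any w
   into the kernel of a_max. *)
pose shear u := u - dot u y *: a ord_max.
have shearE u w : dot (shear u) w = dot u (w - dot (a ord_max) w *: y).
  by rewrite /shear dotDl dotDr dotNl dotNr dotZl [in RHS]dotZr mulrC.
have [w aw|beta [beta0 vE]] := IHr (fun i => shear (a' i)) (shear v).
  rewrite shearE; apply: av; apply: split_ord => [i|]; first by rewrite -shearE.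
  by rewrite dotDr dotNr dotZr amy mulr1 subrr.
(* This is the coefficient of a_max obtained by expanding every [shear] in vE. *)
exists (glue beta (dot v y - \sum_i beta i * dot (a' i) y)); split.
  apply: glue_ge0 => //; rewrite subr_ge0; apply: le_trans (ltW vy).
  by apply: sumr_le0 => i _; rewrite mulr_ge0_le0.
rewrite glueE; apply: (addIr (- (dot v y *: a ord_max))).
rewrite -[LHS]/(shear v) vE scalerBl -[RHS]addrA [X in _ + X]addrAC subrr add0r.
rewrite scaler_suml -sumrB; apply: eq_bigr => i _.
by rewrite /shear scalerBr scalerA.
Qed.

(** * First-order information *)

Lemma dot_gradient (R : realType) (k : nat) (h : 'rV[R]_k -> R) (p d : 'rV[R]_k) :
  differentiable h p -> dot (gradient h p) d = 'D_d h p.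
Proof.
move=> dh; rewrite deriveE // {2}(row_sum_delta d) linear_sum /=.
by apply: eq_bigr => j _; rewrite linearZ /= mxE deriveE // mulrC.
Qed.

(** The graph of a convex function lies above its tangents: difference quotients
    from p towards q at scale t <= 1 are bounded by the one at scale 1, and
    so is their limit as t decreases to 0. *)
Lemma convex_gradient_le (R : realType) (k : nat) (h : 'rV[R]_k -> R)
    (p q : 'rV[R]_k) :
  convex_on_space h -> differentiable h p ->
  dot (gradient h p) (q - p) <= h q - h p.
Proof.
move=> ch dh; rewrite dot_gradient //.
have /cvg_dnbhs_at_right cvgD := @diff_derivable _ _ _ h p (q - p) dh.
apply: (cvgr_to_le cvgD); near=> t.
have t0 : 0 < t by near: t; exact: nbhs_right_gt.
have t1 : t <= 1 by near: t; exact: nbhs_right_le.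
have := ch (Itv01 (ltW t0) t1) q p; rewrite !inE => /(_ I I).
rewrite convRE => hc.
have conv_qp : @conv _ (convex_lmodType 'rV[R]_k) (Itv01 (ltW t0) t1) q p =
    t *: (q - p) + p.
  rewrite -[LHS]/(t *: q + (1 - t) *: p) scalerBl scale1r scalerBr.
  by rewrite addrA addrAC.
move: hc; rewrite conv_qp /= => hc.
rewrite -[_ *: _]/(t^-1 * _) mulrC ler_pdivrMr //.
move: hc; rewrite /unstable.onem /=; lra.
Unshelve. all: by end_near. Qed.

(** * The subproblem over the cone of first-order feasible directions *)

Section UCNP.
Variables (R : realType) (n m r : nat) (rho : R) (g : 'rV[R]_(n + m) -> R).
Variables (gs : 'I_r -> 'rV[R]_(n + m) -> R) (p : 'rV[R]_(n + m)).

Lemma UCNP_objectiveD (d z : 'rV[R]_(n + m)) :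
  UCNP_objective rho g p (d + z) = UCNP_objective rho g p d
    + dot (rho *: d + gradient g p) z + rho / 2 * dot z z.
Proof.
rewrite /UCNP_objective !enorm2 !(dotDl, dotDr, dotZl) (dotC z d).
by field.
Qed.

(** Along an admissible segment the objective changes by t s + t^2 rho/2 |z|^2,
    where s is the slope at d; this is negative for small t > 0 as soon as
    s < 0. *)
Lemma UCNP_optimal_stationary (d z : 'rV[R]_(n + m)) :
  0 < rho -> UCNP_optimal rho g gs p d ->
  (forall t, 0 < t <= 1 -> Tcone gs p (d + t *: z)) ->
  0 <= dot (rho *: d + gradient g p) z.
Proof.
move=> rho0 [_ dmin] dz; rewrite leNgt; apply/negP.
set s := dot _ _ => s0.
have q0 := mulr_ge0 (ltW rho0) (dotvv_ge0 z).
have den0 : 0 < rho * dot z z - s by lra.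
(* The quadratic is negative on ]0, -2 s / (rho |z|^2)[; adding - s to the
   denominator gives a step in this interval that is also at most 1 and makes
   sense when z = 0. *)
pose t := - s / (rho * dot z z - s).
have tE : t * (rho * dot z z - s) = - s by rewrite divfK // gt_eqF.
have t0 : 0 < t by rewrite divr_gt0 // oppr_gt0.
have t1 : t <= 1 by rewrite ler_pdivrMr // mul1r; lra.
have := dmin _ (dz t _); rewrite t0 t1 => /(_ isT).
rewrite UCNP_objectiveD dotZr dotZl dotZr -/s => H.
have : 0 <= t * (s + rho * dot z z * t / 2) by lra.
rewrite pmulr_rge0 //.
nra.
Qed.

(** The cone T(p) is closed under adding its elements and under shrinking, so
    the slope of the objective at d is nonnegative along every w in T(p) and
    along - d; the former feeds Farkas' lemma, the latter yields complementary
    slackness. *)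
Lemma UCNP_optimal_KKT (d : 'rV[R]_(n + m)) :
  0 < rho -> UCNP_optimal rho g gs p d ->
  exists alpha : 'I_r -> R,
    (forall i, 0 <= alpha i) /\ UCNP_KKT rho g gs p d alpha.
Proof.
move=> rho0 dopt; have [dT _] := dopt.
have cd : 0 <= dot (- (rho *: d + gradient g p)) d.
  rewrite dotNl -dotNr; apply: UCNP_optimal_stationary dopt _ => // t /andP[_ t1] i.
  rewrite scalerN -scaleNr -[X in X + _]scale1r -scalerDl dotZr.
  by rewrite mulr_ge0_le0 ?subr_ge0 ?dT.
have [w wT|alpha [alpha0 cE]] :=
    @farkas _ _ _ (fun i => gradient (gs i) p) (- (rho *: d + gradient g p)).
  rewrite dotNl oppr_le0; apply: UCNP_optimal_stationary dopt _ => // t /andP[t0 _] i.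
  by rewrite dotDr dotZr ler_wnDl ?dT // mulr_ge0_le0 ?wT // ltW.
exists alpha; split=> //; split; first by rewrite -cE subrr.
have term_le0 i : alpha i * dot (gradient (gs i) p) d <= 0.
  by rewrite mulr_ge0_le0 ?dT.
have sum0 : \sum_i - (alpha i * dot (gradient (gs i) p) d) = 0.
  apply/eqP; rewrite eq_le sumr_ge0 ?andbT => [|i _]; last by rewrite oppr_ge0.
  rewrite sumrN oppr_le0 (le_trans cd) // cE dot_suml.
  by under eq_bigr do rewrite dotZl.
move=> i; apply: oppr_inj; rewrite oppr0.
by apply: (psumr_eq0P _ sum0) => // j _; rewrite oppr_ge0.
Qed.

Lemma UCNP_KKT_optimal (d : 'rV[R]_(n + m)) (alpha : 'I_r -> R) :
  0 < rho -> Tcone gs p d -> (forall i, 0 <= alpha i) ->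
  UCNP_KKT rho g gs p d alpha -> UCNP_optimal rho g gs p d.
Proof.
move=> rho0 dT alpha0 [/eqP + compl]; rewrite addr_eq0 => /eqP cE.
split=> // w wT; rewrite -[w](subrKC d) UCNP_objectiveD cE -addrA lerDl.
rewrite addr_ge0 //; last by rewrite mulr_ge0 ?dotvv_ge0 // divr_ge0 // ltW.
rewrite dotNl oppr_ge0 dot_suml sumr_le0 // => i _.
by rewrite dotZl dotDr dotNr mulrBr compl subr0 mulr_ge0_le0 ?wT.
Qed.

(** Each g_i takes the same value at p and q, so its tangent inequality between
    them reads grad g_i(p).(q - p) <= 0. *)
Lemma feasible_direction_Tcone (q : 'rV[R]_(n + m)) :
  (forall i, convex_on_space (gs i)) -> (forall i, differentiable (gs i) p) ->
  Xcstr gs p -> Xcstr gs q -> Tcone gs p (q - p).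
Proof.
move=> gs_convex gs_diff pX qX i.
apply: le_trans (convex_gradient_le _ (gs_convex i) (gs_diff i)) _.
by rewrite pX qX subrr.
Qed.
End UCNP.

Unset Implicit Arguments.

Theorem corollary3p1 (R : realType) (n m r : nat) (hr : (0 < r)%N)
  (f : 'rV[R]_n -> R) (g : 'rV[R]_(n + m) -> R)
  (gs : 'I_r -> 'rV[R]_(n + m) -> R) (rho : R)
  (hf : uniform_CN_form rho f g gs)
  (hg : twice_differentiable g) (hgs : forall i, twice_differentiable (gs i))
  (xs : 'rV[R]_n) (ys : 'rV[R]_m) (hX : Xfun f g gs (row_mx xs ys)) :
  (forall ds : 'rV[R]_(n + m),
     UCNP_optimal rho g gs (row_mx xs ys) ds ->
     (0 <= UCNP_objective rho g (row_mx xs ys) ds ->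
        CNP_optimal g gs (row_mx xs ys) /\ CNO_optimal f xs)
     /\
     ((exists d' : 'rV[R]_(n + m),
         forall i, dot (gradient (gs i) (row_mx xs ys)) d' < 0) ->
      exists alpha : 'I_r -> R,
        (forall i, 0 <= alpha i) /\
        UCNP_KKT rho g gs (row_mx xs ys) ds alpha))
  /\
  (forall (ds : 'rV[R]_(n + m)) (alpha : 'I_r -> R),
     Tcone gs (row_mx xs ys) ds ->
     (forall i, 0 <= alpha i) ->
     UCNP_KKT rho g gs (row_mx xs ys) ds alpha ->
     UCNP_optimal rho g gs (row_mx xs ys) ds).
Proof.
have [[_ _ gs_convex f_min] [rho0 g_unif]] := hf.
case: hX => pX; rewrite row_mxKl => fxs.
split=> [ds ds_opt|ds alpha]; last exact: UCNP_KKT_optimal.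
split=> [ds_ge0|_]; last exact: UCNP_optimal_KKT ds_opt.
have p_min q : Xcstr gs q -> g (row_mx xs ys) <= g q.
  move=> qX; have := g_unif (row_mx xs ys) (q - row_mx xs ys).
  rewrite subrKC => /(le_trans _) gq; rewrite -subr_ge0 gq //.
  apply: (le_trans ds_ge0); apply: ds_opt.2.
  by apply: feasible_direction_Tcone => // i; exact: (hgs i).1.
split; split=> // x _; have [y [[yX _] fx]] := f_min x.
by rewrite fxs fx p_min.
Qed.
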